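(* Let $\mathcal{D} = (V,E)$ be a directed acyclic graph with vertex set $V = \{1,\ldots,n\}$. Let $\rho = (\rho_g)_{g \in J(\mathcal{D}^{\mathrm{tr}})}$ be the map parameterizing the conjunctive Bayesian network (CBN) model on the poset $\mathcal{D}^{\mathrm{tr}}$, and let $\psi = (\psi_h)_{h \in \mathcal{G}(\mathcal{D},2)}$ be the map parameterizing the $2$-state discrete max-linear Bayesian network (D-MLBN) model on $\mathcal{D}$. Then $\mathrm{image}(\rho)$ is equal to $\mathrm{image}(\psi)$ after a relabeling of coordinates. In particular, there exists a bijection $\phi : J(\mathcal{D}^{\mathrm{tr}}) \to \mathcal{G}(\mathcal{D},2)$ such that for every $g \in J(\mathcal{D}^{\mathrm{tr}})$ and all parameters $\theta^{(i)} = (\theta_0^{(i)}, \theta_1^{(i)})$, $i \in V$, with $\theta_0^{(i)}, \theta_1^{(i)} \geq 0$ and $\theta_0^{(i)} + \theta_1^{(i)} = 1$, \[ \rho_g(\theta_0^{(1)}, \theta_1^{(1)}, \ldots, \theta_0^{(n)}, \theta_1^{(n)}) = \psi_{\phi(g)}(\theta_1^{(1)}, \theta_0^{(1)}, \ldots, \theta_1^{(n)}, \theta_0^{(n)}), \] and identifying the coordinates indexed by $J(\mathcal{D}^{\mathrm{tr}})$ with those indexed by $\mathcal{G}(\mathcal{D},2)$ via $\phi$ gives $\mathrm{image}(\rho) = \mathrm{image}(\psi)$.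
   Context: For a DAG $\mathcal{D}$ on $V=\{1,\ldots,n\}$, $\mathrm{pa}(i)$ (parents of $i$) is the set of $j$ with an edge $j \to i$ in $E$. The transitive closure poset $\mathcal{D}^{\mathrm{tr}}$ is the poset on $V$ with $j \leq i$ if and only if $j = i$ or there is a directed path from $j$ to $i$ in $\mathcal{D}$. For a finite poset $P$, an order ideal is a subset $I \subseteq P$ such that $i \in I$ and $j \leq i$ imply $j \in I$; $J(P)$ is the lattice of order ideals of $P$ ordered by inclusion. An order ideal $g$ is also viewed as the 0-1 vector $(g_i)_{i\in P}$ with $g_i = 1$ if and only if $i \in g$. CBN model on a poset $P$ with ground set $[n]$: the state space is $J(P)$. Form the DAG with an edge $i \to j$ whenever $j$ covers $i$ in $P$ (that is, $i<j$ with no element strictly between), and let $\mathrm{pa}_P(i)$ denote the parents of $i$ in this DAG. The parameters are $(\theta_0^{(i)}, \theta_1^{(i)})$ for $i \in P$, nonnegative with $\theta_0^{(i)} + \theta_1^{(i)} = 1$. The model is the directed graphical model on binary variables $X_i$ with the following conditional probabilities: if $a_j = 1$ for all $j \in \mathrm{pa}_P(i)$ (in particular if $\mathrm{pa}_P(i)=\emptyset$), then $P(X_i = b \mid X_{\mathrm{pa}_P(i)} = a) = \theta_b^{(i)}$ for $b \in \{0,1\}$; otherwise $P(X_i = 0 \mid X_{\mathrm{pa}_P(i)} = a) = 1$ and $P(X_i = 1 \mid X_{\mathrm{pa}_P(i)} = a) = 0$. The parameterization is $\rho_g(\theta) = \prod_{i \in P} P(X_i = g_i \mid X_{\mathrm{pa}_P(i)}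 = g_{\mathrm{pa}_P(i)})$ for $g \in J(P)$. $k$-state D-MLBN model on $\mathcal{D}$: let $Z_i$, $i \in V$, be independent random variables with states $\{0,\ldots,k-1\}$, with $Z_i$ having distribution $\theta^{(i)} = (\theta_0^{(i)}, \ldots, \theta_{k-1}^{(i)})$ in the probability simplex $\Delta_{k-1}$; the model is the family of joint distributions of $(X_i)_{i\in V}$ defined by $X_i = \bigvee_{j \in \mathrm{pa}(i)} X_j \vee Z_i$, where $\vee$ denotes maximum. The state space $\mathcal{G}(\mathcal{D},k)$ is the set of $g = (g_1,\ldots,g_n) \in \{0,\ldots,k-1\}^n$ such that $i \mapsto g_i$ is an order-preserving map $\mathcal{D}^{\mathrm{tr}} \to \{0 < 1 < \cdots < k-1\}$. The parameterization is $\psi_g(\theta) = P(X = g) = \prod_{i \in V} P(X_i = g_i \mid X_{\mathrm{pa}(i)} = g_{\mathrm{pa}(i)})$ for $g \in \mathcal{G}(\mathcal{D},k)$, where, with $M_i = \bigvee_{j \in \mathrm{pa}(i)} g_j$ (and $M_i = 0$ if $\mathrm{pa}(i) = \emptyset$), the conditional probability $P(X_i = g_i \mid X_{\mathrm{pa}(i)} = g_{\mathrm{pa}(i)})$ equals $0$ if $g_i < M_i$, equals $\sum_{\ell \leq M_i} \theta_\ell^{(i)}$ if $g_i = M_i$, and equals $\theta_{g_i}^{(i)}$ if $g_i > M_i$. The $2$-state model is the case $k=2$. *)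

(* Defs.v *)
From HB Require Import structures.
From mathcomp Require Import all_boot all_order all_algebra.
From mathcomp Require Import all_classical all_reals.

Set Implicit Arguments.
Unset Strict Implicit.
Unset Printing Implicit Defensive.

Import Order.TTheory GRing.Theory Num.Theory.

(* [path.cycle e c] is a closed directed walk; the one-vertex sequence
   [:: x] is a cycle exactly when [e x x], so loops are excluded too. *)
Record dag (n : nat) := Dag {
  edge : rel 'I_n;
  dag_acyclic : forall c : seq 'I_n, c != [::] -> ~~ cycle edge c }.

Definition parents n (D : dag n) (i : 'I_n) : {set 'I_n} :=
  [set j | edge D j i].

(* The transitive closure poset: an alias of the vertex set ordered by
   reachability ([connect] is the reflexive transitive closure). *)
Definition dag_tr n (D : dag n) : Type := 'I_n.

Fact dag_tr_display : Order.disp_t. Proof. exact: Order.Disp. Qed.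

Section DagTr.
Variables (n : nat) (D : dag n).

HB.instance Definition _ := Finite.on (dag_tr D).

Definition dag_tr_le : rel (dag_tr D) := connect (edge D).

Fact dag_tr_le_refl : reflexive dag_tr_le.
Proof. exact: connect0. Qed.

Fact dag_tr_le_anti : antisymmetric dag_tr_le.
Proof.
move=> x y /andP[/connectP[p px ylast] /connectP[q qy xlast]].
case: p px ylast => [_ -> //|z p /= pz ylast].
have [] := negP (@dag_acyclic n D ((z :: p) ++ q) isT).
move: pz ylast => /= /andP[xz zp] ylast.
by rewrite rcons_path cat_path zp last_cat -ylast qy -xlast xz.
Qed.

Fact dag_tr_le_trans : transitive dag_tr_le.
Proof. exact: connect_trans. Qed.

HB.instance Definition _ := Order.Le_isPOrder.Build dag_tr_display (dag_tr D)
  dag_tr_le_refl dag_tr_le_anti dag_tr_le_trans.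

End DagTr.

Lemma le_dag_trE n (D : dag n) (j i : dag_tr D) :
  (j <= i)%O = connect (edge D) j i.
Proof. by []. Qed.

Section Posets.
Local Open Scope order_scope.
Variables (d : Order.disp_t) (P : finPOrderType d).

Definition covers (j i : P) : bool :=
  (i < j) && [forall m : P, ~~ ((i < m) && (m < j))].

Definition is_order_ideal (I : {set P}) : bool :=
  [forall i in I, forall j, (j <= i) ==> (j \in I)].

Definition order_ideals : Type := {I : {set P} | is_order_ideal I}.

Definition ideal_vec (I : order_ideals) (i : P) : 'I_2 := inord (i \in val I).

End Posets.

Local Open Scope ring_scope.

Definition simplex (R : realType) (k : nat) : set ('I_k -> R) :=
  [set t | (forall l, 0 <= t l) /\ \sum_(l < k) t l = 1].

Definition params (R : realType) (T : Type) (k : nat) : set (T -> 'I_k -> R) :=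
  [set theta | forall i, simplex (theta i)].
Arguments params : clear implicits.

Section CBN.
Variables (R : realType) (d : Order.disp_t) (P : finPOrderType d).

Definition cbn_pa (i : P) : {set P} := [set j | covers i j].

(* P(X_i = b | X_pa = a); only the values of [a] on [cbn_pa i] matter. *)
Definition cbn_cprob (theta : P -> 'I_2 -> R) (i : P) (b : 'I_2)
    (a : P -> 'I_2) : R :=
  if [forall j in cbn_pa i, a j == 1%N :> nat] then theta i b
  else (b == 0%N :> nat)%:R.

Definition cbn_rho (theta : P -> 'I_2 -> R) (g : order_ideals P) : R :=
  \prod_(i : P) cbn_cprob theta i (ideal_vec g i) (ideal_vec g).

End CBN.
Arguments cbn_rho {R d} P theta g.

Section MLBN.
Variables (R : realType) (n : nat) (D : dag n) (k : nat).

Definition is_mlbn_state (g : {ffun 'I_n -> 'I_k}) : bool :=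
  [forall j : dag_tr D, forall i : dag_tr D,
    (j <= i)%O ==> (g j <= g i)%N].

Definition mlbn_states : Type := {g : {ffun 'I_n -> 'I_k} | is_mlbn_state g}.

(* The natural-number maximum over an empty parent set is 0. *)
Definition parents_max (a : 'I_n -> 'I_k) (i : 'I_n) : nat :=
  \max_(j in parents D i) (a j : nat).

Definition mlbn_cprob (theta : 'I_n -> 'I_k -> R) (i : 'I_n) (b : 'I_k)
    (a : 'I_n -> 'I_k) : R :=
  let M := parents_max a i in
  if (b < M)%N then 0
  else if (b == M :> nat) then \sum_(l < k | (l <= M)%N) theta i l
  else theta i b.

Definition mlbn_psi (theta : 'I_n -> 'I_k -> R) (g : mlbn_states) : R :=
  \prod_(i < n) mlbn_cprob theta i (val g i) (val g).

(* The product formula is the law of the solution X = g of the recursion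
   X_i = max(max_(j in pa(i)) X_j, Z_i) with independent Z_i ~ theta_i. *)
Lemma mlbn_psi_law (theta : 'I_n -> 'I_k -> R) (g : mlbn_states) :
  mlbn_psi theta g =
  \sum_(z : {ffun 'I_n -> 'I_k} |
      [forall i, val g i == maxn (parents_max (val g) i) (z i) :> nat])
    \prod_(i < n) theta i (z i).
Proof.
pose Q i (l : 'I_k) := val g i == maxn (parents_max (val g) i) l :> nat.
transitivity (\prod_(i < n) \sum_(l < k | Q i l) theta i l); last first.
  rewrite (bigA_distr_big_dep (fun i l => Q i l)); apply: eq_bigl => z.
  by apply/familyP/forallP => zP i; have := zP i.
apply: eq_bigr => i _; rewrite /mlbn_cprob /Q.
set M := parents_max _ i; set b := (val g i).
case: (ltngtP b M) => bM /=.
- by rewrite big_pred0 // => l; rewrite ltn_eqF // leq_max bM.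
- rewrite (big_pred1 b) // => l; rewrite /= -val_eqE /=.
  case: (leqP M l) => Ml; first by rewrite eq_sym.
  by rewrite gtn_eqF // ltn_eqF // (ltn_trans Ml).
- by apply: eq_bigl => l; rewrite bM eq_sym; apply/idP/eqP => /maxn_idPl.
Qed.

End MLBN.
Arguments mlbn_psi {R n} D k theta g.

Definition swap_params (R : realType) (T : Type) (theta : T -> 'I_2 -> R) :
  T -> 'I_2 -> R := fun i b => theta i (rev_ord b).

(* Main.v *)
(** Under the relabeling [0 <-> 1], the order ideal [I] corresponds to the state
  which is 0 exactly on [I]. For an ideal [I], "all elements covered by [i] lie in [I]"
  and "all parents of [i] in the DAG lie in [I]" are both equivalent to "all
  elements strictly below [i] lie in [I]", although the two parent sets differ in
  general; hence the two products agree factor by factor. *)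
Require Import Defs.
From HB Require Import structures.
From mathcomp Require Import all_boot all_order all_algebra.
From mathcomp Require Import all_classical all_reals.

Set Implicit Arguments.
Unset Strict Implicit.

Import Order.TTheory.

Local Open Scope classical_set_scope.
Local Open Scope ring_scope.

(** Among the elements at or above [j] and strictly below [i], one with a largest down-set is
    maximal, so nothing lies strictly between it and [i]. *)
Lemma exists_covers_ge d (P : finPOrderType d) (i j : P) :
  (j < i)%O -> exists2 m, covers i m & (j <= m)%O.
Proof.
move=> ji; pose below (m : P) := [set x : P | (x <= m)%O]%SET.
pose Q m := (j <= m)%O && (m < i)%O.
have Qj : Q j by rewrite /Q lexx ji.
case: (arg_maxnP (fun m => #|below m|) Qj) => m /andP[jm mi] mmax.
exists m => //; rewrite /covers mi /=; apply/forallP => p.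
apply/negP => /andP[mp pi].
have := mmax p; rewrite /Q pi (le_trans jm (ltW mp)) => /(_ isT).
(* The down-set of [p] contains that of [m] and also [p] itself, against the choice of [m]. *)
apply/negP; rewrite -ltnNge; apply: proper_card; apply/properP; split.
  by apply/fintype.subsetP => x; rewrite !inE => /le_trans; apply; exact: ltW.
by exists p; rewrite !inE ?lexx // lt_geF.
Qed.

Lemma edge_lt n (D : dag n) (j i : dag_tr D) : edge D j i -> (j < i)%O.
Proof.
move=> ji; rewrite lt_neqAle le_dag_trE connect1 // andbT.
(* If [j = i], the edge is a loop, which is a cycle with one vertex. *)
apply: contraTneq ji => ->.
by have := @dag_acyclic n D [:: i] isT; rewrite /= andbT.
Qed.

(** A nonempty path from [j] to [i] ends with an edge into [i]; the source of that edge is the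
    required parent. *)
Lemma exists_parent_ge n (D : dag n) (j i : dag_tr D) :
  (j < i)%O -> exists2 m : dag_tr D, edge D m i & (j <= m)%O.
Proof.
rewrite lt_neqAle le_dag_trE => /andP[+ /connectP[p]].
case/lastP: p => [|p x] + + ei; first by rewrite ei /= eqxx.
rewrite {}ei last_rcons rcons_path => _ /andP[jp px].
by exists (last j p) => //; rewrite le_dag_trE; apply/connectP; exists p.
Qed.

Lemma order_idealP d (P : finPOrderType d) (I : {set P}) :
  reflect (forall i j, i \in I -> (j <= i)%O -> j \in I) (is_order_ideal I).
Proof.
apply: (iffP forall_inP) => [idI i j /idI /forallP /(_ j) /implyP // | idI i iI].
by apply/forallP => j; apply/implyP; exact: idI.
Qed.

(** Each parent of [i] lies at or below an element covered by [i], and each element covered by [i]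
    lies at or below a parent; membership in [I] passes downwards. *)
Lemma ideal_covers_parents n (D : dag n) (I : order_ideals (dag_tr D))
    (i : dag_tr D) :
  [forall j in cbn_pa i, j \in val I] = [forall j in parents D i, j \in val I].
Proof.
have /order_idealP idI := valP I.
apply/forall_inP/forall_inP => paI j; rewrite inE.
  move=> /edge_lt /exists_covers_ge[m im jm].
  by apply: (idI m _ _ jm); apply: paI; rewrite inE.
move=> /andP[/exists_parent_ge[m mi jm] _].
by apply: (idI m _ _ jm); apply: paI; rewrite inE.
Qed.

Lemma ideal_state_subproof n (D : dag n) (I : order_ideals (dag_tr D)) :
  @is_mlbn_state n D 2 [ffun i => inord (i \notin val I)].
Proof.
have /order_idealP idI := valP I.
apply/forallP => j; apply/forallP => i; apply/implyP => ji.
rewrite !ffunE !inordK ?ltnS ?leq_b1 //.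
by case: (boolP (i \in _)) => [/idI/(_ ji) ->|_] //; exact: leq_b1.
Qed.

Definition ideal_state n (D : dag n) (I : order_ideals (dag_tr D)) :
  mlbn_states D 2 := exist (fun g => is_mlbn_state D g) _ (ideal_state_subproof I).

Lemma ideal_stateE n (D : dag n) (I : order_ideals (dag_tr D)) i :
  val (ideal_state I) i = (i \notin val I) :> nat.
Proof. by rewrite ffunE inordK // ltnS leq_b1. Qed.

Lemma state_ideal_subproof n (D : dag n) (g : mlbn_states D 2) :
  @is_order_ideal _ (dag_tr D) [set i | val g i == 0%N :> nat]%SET.
Proof.
apply/order_idealP => i j; rewrite !inE => /eqP gi ji.
have /forallP /(_ j) /forallP /(_ i) /implyP /(_ ji) := valP g.
by rewrite gi leqn0.
Qed.

Definition state_ideal n (D : dag n) (g : mlbn_states D 2) :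
  order_ideals (dag_tr D) :=
  exist (fun I : {set dag_tr D} => is_order_ideal I) _ (state_ideal_subproof g).

Lemma ideal_stateK n (D : dag n) : cancel (@ideal_state n D) (@state_ideal n D).
Proof.
move=> I; apply/val_inj/setP => i.
by rewrite inE ideal_stateE; case: (i \in _).
Qed.

Lemma state_idealK n (D : dag n) : cancel (@state_ideal n D) (@ideal_state n D).
Proof.
move=> g; apply/val_inj/ffunP => i; apply: ord_inj.
rewrite ideal_stateE inE.
by case: (val g i) => -[|[|]].
Qed.

Lemma swap_paramsK (R : realType) T : involutive (@swap_params R T).
Proof. by move=> t; apply/funext => i; apply/funext => b; rewrite /swap_params rev_ordK. Qed.

Lemma swap_params_in (R : realType) T (theta : T -> 'I_2 -> R) :
  params R T 2 theta -> params R T 2 (swap_params theta).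
Proof.
move=> th i; have [th0 th1] := th i; split => [l|]; first exact: th0.
by rewrite -th1 [RHS](reindex_inj rev_ord_inj).
Qed.

Lemma parents_max_ideal_state n (D : dag n) (I : order_ideals (dag_tr D)) i :
  parents_max D (val (ideal_state I)) i
    = ~~ [forall j in parents D i, j \in val I] :> nat.
Proof.
rewrite /parents_max; case: forall_inP => /= [paI|paI].
  by rewrite big1 // => j /paI jI; rewrite ideal_stateE jI.
apply/eqP; rewrite eqn_leq; apply/andP; split.
  by apply/bigmax_leqP => j _; rewrite ideal_stateE leq_b1.
move/forall_inP: paI; rewrite negb_forall_in => /exists_inP[j ji jI].
apply: leq_trans (leq_bigmax_cond _ ji).
by rewrite ideal_stateE jI.
Qed.

Lemma cbn_mlbn_cprob (R : realType) n (D : dag n) (I : order_ideals (dag_tr D))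
    (theta : 'I_n -> 'I_2 -> R) (i : dag_tr D) : simplex (theta i) ->
  cbn_cprob (P := dag_tr D) theta i (ideal_vec I i) (ideal_vec I)
  = mlbn_cprob D (swap_params theta) i (val (ideal_state I) i)
      (val (ideal_state I)).
Proof.
move=> [_ th1]; rewrite /mlbn_cprob parents_max_ideal_state ideal_stateE /cbn_cprob.
have vecE (j : dag_tr D) : ideal_vec I j = (j \in val I) :> nat.
  by rewrite /ideal_vec inordK // ltnS leq_b1.
have -> : [forall j in cbn_pa i, ideal_vec I j == 1%N :> nat]
        = [forall j in parents D i, j \in val I].
  rewrite -ideal_covers_parents; apply: eq_forallb => j.
  by rewrite vecE eqb1.
case: ifP => /= [_|paI].
  (* All parents lie in [I], so the maximum is 0. For [i] in [I] the sum has only the term at 0,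
     which the swap turns into the parameter at 1; otherwise the state is 1 and the swap gives the
     parameter at 0. *)
  rewrite eqb0 negbK; case: ifP => iI.
    rewrite (big_pred1 ord0) => [|l]; last by rewrite leqn0.
    by congr (theta i _); apply: ord_inj; rewrite vecE iI.
  congr (theta i _); apply: ord_inj.
  by rewrite -[RHS]/(2 - (val (ideal_state I) i).+1)%N ideal_stateE vecE iI.
(* Some parent lies outside [I], hence so does [i]. The CBN factor is then 1; state and maximum are
   both 1, so the max-linear factor is the full sum of [theta i], again 1. *)
have iI : i \notin val I.
  apply: contraFN paI => iI; apply/forall_inP => j; rewrite inE => /edge_lt ji.
  by have /order_idealP /(_ i j iI (ltW ji)) := valP I.
rewrite vecE (negPf iI) /= -th1 (reindex_inj rev_ord_inj) /=.
by apply: eq_bigl => l; rewrite -ltnS ltn_ord.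
Qed.

Lemma cbn_rho_mlbn_psi (R : realType) n (D : dag n)
    (I : order_ideals (dag_tr D)) (theta : 'I_n -> 'I_2 -> R) :
  params R 'I_n 2 theta ->
  cbn_rho (dag_tr D) theta I = mlbn_psi D 2 (swap_params theta) (ideal_state I).
Proof. by move=> th; apply: eq_bigr => i _; apply: cbn_mlbn_cprob. Qed.

Unset Implicit Arguments.

Theorem theorem3p3 (R : realType) (n : nat) (D : dag n) :
  exists phi : order_ideals (dag_tr D) -> mlbn_states D 2,
    [/\ bijective phi,
        forall (g : order_ideals (dag_tr D)) (theta : 'I_n -> 'I_2 -> R),
          params R 'I_n 2 theta ->
          cbn_rho (dag_tr D) theta g
            = mlbn_psi D 2 (swap_params theta) (phi g)
      & cbn_rho (dag_tr D) @` params R (dag_tr D) 2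
        = (fun x : mlbn_states D 2 -> R => x \o phi)
            @` (mlbn_psi D 2 @` params R 'I_n 2)].
Proof.
exists (@ideal_state n D); split.
- exact: Bijective (@ideal_stateK n D) (@state_idealK n D).
- by move=> g theta; exact: cbn_rho_mlbn_psi.
apply/seteqP; split => [_ [theta th <-]|_ [_ [theta th <-] <-]].
  exists (mlbn_psi D 2 (swap_params theta)).
    by exists (swap_params theta) => //; exact: swap_params_in.
  by apply/funext => g /=; rewrite cbn_rho_mlbn_psi.
(* The swap is an involution, so swapping these parameters again recovers [theta]. *)
exists (swap_params theta); first exact: swap_params_in.
apply/funext => g /=; rewrite cbn_rho_mlbn_psi ?swap_paramsK //.
exact: swap_params_in.
Qed.
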